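(* Let $G_1$ and $G_2$ be two connected graphs, each with $n$ vertices and $m$ edges, having Laplacian spectra $0=\mu_n<\mu_{n-1}\leq\cdots\leq\mu_1$ and $0=\lambda_n<\lambda_{n-1}\leq\cdots\leq\lambda_1$, respectively, and with algebraic connectivities $\mu_{n-1},\lambda_{n-1}$ greater than one. Let $p$ be a positive integer such that $$\frac{2m}{p+n}<\min(\mu_{n-1}-1,\lambda_{n-1}-1).$$ Then $LE(\overline{G_1}\vee K_p)=LE(\overline{G_2}\vee K_p)$.
   Context: All graphs are finite, undirected and simple. For a graph $G$ with $N$ vertices and $M$ edges, adjacency matrix $A(G)$ and diagonal degree matrix $D(G)$, the Laplacian matrix is $L(G)=D(G)-A(G)$; its eigenvalues with multiplicity, $\mu_1,\dots,\mu_N$, form the Laplacian spectrum of $G$. The algebraic connectivity is the second smallest Laplacian eigenvalue. The Laplacian energy is $LE(G)=\sum_{i=1}^{N}\left|\mu_i-\frac{2M}{N}\right|$. $\overline{G}$ is the complement of $G$, $K_p$ the complete graph on $p$ vertices, and the join $G\vee H$ is obtained from the disjoint union of $G$ and $H$ by adding all edges between vertices of $G$ and vertices of $H$. *)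

(* Defs.v *)
From HB Require Import structures.
From mathcomp Require Import all_boot all_order all_algebra.
From mathcomp Require Import polyrcf complex sesquilinear spectral.

Set Implicit Arguments.
Unset Strict Implicit.
Unset Printing Implicit Defensive.

Import Order.TTheory GRing.Theory Num.Theory.
Local Open Scope ring_scope.

Record sgraph (T : finType) := SGraph {
  adj :> rel T;
  adj_sym : symmetric adj;
  adj_irr : irreflexive adj }.

Definition edges (T : finType) (G : sgraph T) : {set {set T}} :=
  [set [set e.1; e.2] | e : T * T & G e.1 e.2].

Definition deg (T : finType) (G : sgraph T) (x : T) : nat :=
  #|[set y | G x y]|.

Definition connected (T : finType) (G : sgraph T) : Prop :=
  (0 < #|T|)%N /\ forall x y : T, connect G x y.

Section Operations.
Variables (T U : finType) (G : sgraph T) (H : sgraph U).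

Definition compl_adj : rel T := fun x y => (x != y) && ~~ G x y.

Lemma compl_adj_sym : symmetric compl_adj.
Proof. by move=> x y; rewrite /compl_adj eq_sym adj_sym. Qed.

Lemma compl_adj_irr : irreflexive compl_adj.
Proof. by move=> x; rewrite /compl_adj eqxx. Qed.

Definition compl : sgraph T := SGraph compl_adj_sym compl_adj_irr.

Definition join_adj : rel (T + U)%type := fun u v =>
  match u, v with
  | inl x, inl y => G x y
  | inr x, inr y => H x y
  | _, _ => true
  end.

Lemma join_adj_sym : symmetric join_adj.
Proof. by move=> [x|x] [y|y] //=; rewrite adj_sym. Qed.

Lemma join_adj_irr : irreflexive join_adj.
Proof. by move=> [x|x] /=; rewrite adj_irr. Qed.

Definition join : sgraph (T + U)%type := SGraph join_adj_sym join_adj_irr.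

End Operations.

Section Complete.
Variable p : nat.

Definition complete_adj : rel 'I_p := fun x y => x != y.

Lemma complete_adj_sym : symmetric complete_adj.
Proof. by move=> x y; rewrite /complete_adj eq_sym. Qed.

Lemma complete_adj_irr : irreflexive complete_adj.
Proof. by move=> x; rewrite /complete_adj eqxx. Qed.

Definition complete : sgraph 'I_p := SGraph complete_adj_sym complete_adj_irr.

End Complete.

Lemma char_poly_conj (F : fieldType) n (P D : 'M[F]_n) : P \in unitmx ->
  char_poly (invmx P *m D *m P) = char_poly D.
Proof.
move=> Pu; rewrite /char_poly /char_poly_mx !map_mxM.
set Q := map_mx _ (invmx P); set P' := map_mx _ P; set D' := map_mx _ D.
have QP : Q *m P' = 1%:M by rewrite -map_mxM mulVmx // map_mx1.
have -> : 'X%:M - Q *m D' *m P' = Q *m ('X%:M - D') *m P'.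
  by rewrite mulmxBr mulmxBl scalar_mxC -(mulmxA 'X%:M) QP mulmx1.
rewrite !det_mulmx mulrC mulrA -det_mulmx.
by rewrite (mulmx1C QP) det1 mul1r.
Qed.

Lemma char_poly_sym (R : rcfType) n (A : 'M[R]_n) : A^T = A ->
  exists s : seq R, char_poly A = \prod_(x <- s) ('X - x%:P).
Proof.
move=> Asym; pose f := real_complex R; pose B := map_mx f A.
have Bh : B \is hermsymmx.
  apply: realsym_hermsym.
    by apply/is_hermitianmxP; apply/matrixP => i j;
      rewrite expr0 scale1r !mxE /= -{1}Asym mxE.
  by apply/mxOverP => i j; rewrite mxE; apply/complex_realP; exists (A i j).
have /orthomx_spectralP BE := hermitian_normalmx Bh.
have /mxOverP dR := hermitian_spectral_diag_real Bh.
exists [seq complex.Re (spectral_diag B 0 i) | i <- enum 'I_n].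
apply: (map_poly_inj f); rewrite map_char_poly -/B.
rewrite [in LHS]BE char_poly_conj ?spectral_unit // char_poly_trig; last first.
  by apply: diag_mx_is_trig.
rewrite big_map big_enum rmorph_prod; apply: eq_bigr => i _ /=.
rewrite rmorphB /= map_polyX map_polyC /= mxE eqxx mulr1n.
by have /complex_realP[k ->] := dR 0 i.
Qed.

Lemma prod_mup_rootsR (R : rcfType) (p : {poly R}) (s : seq R) :
  p = \prod_(x <- s) ('X - x%:P) ->
  p = \prod_(x <- flatten [seq nseq (mup x p) x | x <- rootsR p]) ('X - x%:P).
Proof.
move=> ps; have p0 : p != 0 by rewrite ps monic_neq0 // monic_prod_XsubC.
rewrite [LHS]ps; apply: perm_big; apply/allP => x _ /=; apply/eqP.
rewrite -mu_prod_XsubC -ps count_flatten -map_comp.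
have -> : sumn [seq (count_mem x \o (fun y => nseq (mup y p) y)) y
                | y <- rootsR p] = \sum_(y <- rootsR p | y == x) mup x p.
  rewrite sumnE big_map [RHS]big_mkcond; apply: eq_bigr => y _ /=.
  by rewrite count_nseq /=; case: eqP => [->|]; rewrite ?mul1n ?mul0n.
rewrite big_const_seq iter_addn_0 count_uniq_mem; last first.
  exact: (sorted_uniq lt_trans (@ltxx _ _) (sorted_roots _ _ _)).
have := roots_on_rootsR p0 x; rewrite in_itv /= => <-.
by case: (boolP (root p x)) => [|/mupNroot ->]; rewrite ?muln1 ?muln0.
Qed.

Lemma sorted_nseq_rootsR (R : rcfType) (p : {poly R}) (k : R -> nat) :
  sorted <=%R (flatten [seq nseq (k x) x | x <- rootsR p]).
Proof.
have: sorted <%R (rootsR p) by apply: sorted_roots.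
rewrite sorted_pairwise; last exact: lt_trans.
rewrite sorted_pairwise; last exact: le_trans.
elim: (rootsR p) => //= x s IH /andP[xs /IH ps]; rewrite pairwise_cat ps andbT.
apply/andP; split.
  apply/allrelP => y z; rewrite mem_nseq => /andP[_ /eqP ->] /flattenP[t].
  case/mapP => w ws ->; rewrite mem_nseq => /andP[_ /eqP ->].
  by apply: ltW; apply: (allP xs).
by elim: (k x) => //= n ->; rewrite andbT; apply/allP => y;
  rewrite mem_nseq => /andP[_ /eqP ->].
Qed.

Section Spectrum.
Variables (R : rcfType) (T : finType) (G : sgraph T).

Definition adjacency_mx : 'M[R]_#|T| :=
  \matrix_(i, j) (G (enum_val i) (enum_val j))%:R.

Definition degree_mx : 'M[R]_#|T| :=
  diag_mx (\row_i (deg G (enum_val i))%:R).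

Definition laplacian : 'M[R]_#|T| := degree_mx - adjacency_mx.

(* The eigenvalues in nondecreasing order, each repeated according to its
   algebraic multiplicity ([rootsR] lists the distinct roots increasingly).
   Since the Laplacian is symmetric, all its eigenvalues are in R: see
   [char_poly_laplacian]. *)
Definition laplacian_spectrum : seq R :=
  flatten [seq nseq (mup x (char_poly laplacian)) x
          | x <- rootsR (char_poly laplacian)].

Lemma laplacian_sym : laplacian^T = laplacian.
Proof.
rewrite /laplacian linearB /= /degree_mx tr_diag_mx; congr (_ - _).
by apply/matrixP => i j; rewrite !mxE adj_sym.
Qed.

Lemma char_poly_laplacian :
  char_poly laplacian = \prod_(mu <- laplacian_spectrum) ('X - mu%:P).
Proof. by have [s /prod_mup_rootsR] := char_poly_sym laplacian_sym. Qed.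

Lemma sorted_laplacian_spectrum : sorted <=%R laplacian_spectrum.
Proof. exact: sorted_nseq_rootsR. Qed.

Lemma size_laplacian_spectrum : size laplacian_spectrum = #|T|.
Proof.
apply: succn_inj; rewrite -(size_char_poly laplacian) char_poly_laplacian.
by rewrite size_prod_XsubC.
Qed.

(* For #|T| < 2 there is no second smallest eigenvalue and this is 0. *)
Definition algebraic_connectivity : R := nth 0 laplacian_spectrum 1.

Definition laplacian_energy : R :=
  \sum_(mu <- laplacian_spectrum) `|mu - (2 * #|edges G|)%:R / #|T|%:R|.

End Spectrum.

(* Main.v *)
(* Put N = n + p.  The Laplacian spectrum of the join of the complement of G
   with K_p is 0, N (p times) and N - mu for mu in the spectrum of G minus one
   zero, and the average degree is N - 1 - 2m/N.  The condition on p says that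
   mu >= 1 + 2m/N for these mu, so every absolute value in the energy resolves
   and, as the mu sum to 2m, the energy depends on n, m and p only. *)
Require Import Defs.
From mathcomp Require Import all_boot all_order all_algebra.
From mathcomp Require Import fingroup perm zify ring lra.
Import Order.TTheory GRing.Theory Num.Theory.
Local Open Scope ring_scope.

Set Implicit Arguments.
Unset Strict Implicit.
Unset Printing Implicit Defensive.

(** * Determinants *)

(** The two indexings differ by a permutation [s] acting on rows and columns alike, so its sign
    cancels. This lets the vertices of a join be listed in block order. *)
Lemma det_reindex (R : comNzRingType) (T : finType) n (g : 'I_n -> T)
    (F : T -> T -> R) :
  bijective g ->
  \det (\matrix_(i < #|T|, j < #|T|) F (enum_val i) (enum_val j)) =
  \det (\matrix_(i, j) F (g i) (g j)).
Proof.
move=> g_bij; have g_inj := bij_inj g_bij.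
have nT : n = #|T| by rewrite -(bij_eq_card g_bij) card_ord.
subst n; pose s := perm (inj_comp enum_rank_inj g_inj).
set M := (X in \det X = _); set N := (RHS).
have -> : N = \det (row_perm s (col_perm s M)).
  by congr (\det _); apply/matrixP => i j; rewrite !mxE !permE /= !enum_rankK.
rewrite row_permE col_permE !det_mulmx mulrCA -det_mulmx -perm_mxM mulgV.
by rewrite perm_mx1 det1 mulr1.
Qed.

(* Both determinants arise from the bordered matrix [A, -u; v, 1]. *)
Lemma det_rank1_update (R : comNzRingType) n (A : 'M[R]_n)
    (u : 'cV_n) (v : 'rV_n) (c : R) :
  A *m u = c *: u -> \det (A + u *m v) * c = \det A * ((v *m u) 0 0 + c).
Proof.
move=> Au; pose M := block_mx A (- u) v 1%:M.
have detM : \det M = \det (A + u *m v).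
  have: M *m block_mx 1%:M 0 (- v) 1%:M = block_mx (A + u *m v) (- u) 0 1%:M.
    rewrite mulmx_block !mulmx0 !mulmx1 mul1mx mulNmx mulmxN opprK.
    by rewrite subrr !add0r.
  by move/(congr1 determinant); rewrite det_mulmx det_lblock det_ublock !det1 !mulr1.
(* With [c] rather than 1 in the corner, the hypothesis on [u] clears the upper right block without
   a division by [c]. *)
have: M *m block_mx 1%:M u 0 c%:M = block_mx A 0 v (v *m u + c%:M).
  rewrite mulmx_block !mulmx0 !mulmx1 mul1mx !addr0 Au mul_mx_scalar.
  by rewrite scalerN subrr.
move/(congr1 determinant); rewrite det_mulmx detM det_ublock det_lblock.
by rewrite det1 mul1r det_scalar expr1 det_mx11 !mxE eqxx mulr1n.
Qed.

(** Up to sign, the matrix is the characteristic matrix at [- a]. The sign (-1)^n is spread over the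
    linear factors, which must therefore number [n]. *)
Lemma det_scalar_add (F : comNzRingType) n (A : 'M[F]_n) (s : seq F) (a : {poly F}) :
  char_poly A = \prod_(x <- s) ('X - x%:P) -> size s = n ->
  \det (a%:M + map_mx polyC A) = \prod_(x <- s) (a + x%:P).
Proof.
move=> As sn.
have -> : a%:M + map_mx polyC A = - map_mx (comp_poly (- a)) (char_poly_mx A).
  apply/matrixP => i j; rewrite !mxE rmorphB rmorphMn /= comp_polyX comp_polyC.
  by rewrite opprB mulNrn opprK addrC.
rewrite -scaleN1r detZ det_map_mx -[\det _]/(char_poly A) As rmorph_prod.
rewrite -sn; elim: s {As sn} => [|x s IHs]; first by rewrite !big_nil mulr1.
by rewrite !big_cons /= -IHs rmorphB /= comp_polyX comp_polyC exprS; ring.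
Qed.

(** * Degrees and edge counts *)

Lemma deg_sum (T : finType) (G : sgraph T) x : deg G x = (\sum_y G x y)%N.
Proof.
by rewrite /deg -sum1dep_card big_mkcond; apply: eq_bigr => y _; case: (G x y).
Qed.

(** Both sides count ordered pairs of adjacent vertices: each edge comes from exactly two of them,
    its ends being distinct. *)
Lemma handshake (T : finType) (G : sgraph T) :
  (2 * #|edges G|)%N = (\sum_x deg G x)%N.
Proof.
have -> : (\sum_x deg G x = \sum_(e in [set e : T * T | G e.1 e.2]) 1)%N.
  under eq_bigr do rewrite /deg -sum1dep_card.
  by rewrite pair_big_dep; apply: eq_bigl => e; rewrite inE.
rewrite (partition_big_imset (fun e : T * T => [set e.1; e.2])) /=.
rewrite mulnC -sum_nat_const; apply: eq_bigr => _ /imsetP[[x y] Gxy ->].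
rewrite inE /= in Gxy; rewrite sum1dep_card.
have -> : [set e : T * T | (e \in [set e : T * T | G e.1 e.2])
                           && ([set e.1; e.2] == [set x; y])]
        = [set (x, y); (y, x)].
  apply/setP => -[a b]; rewrite !inE /= !xpair_eqE; apply/andP/idP.
    move=> [Gab /eqP/setP ab]; have := (ab a, ab b); rewrite !inE !eqxx orbT /=.
    by case=> /esym/orP[]/eqP ? /esym/orP[]/eqP ?; subst;
      rewrite ?eqxx ?orbT // adj_irr in Gab *.
  by case/orP => /andP[/eqP-> /eqP->]; split=> //;
    rewrite ?(adj_sym G y) // setUC.
rewrite cards2 xpair_eqE; case: eqP => //= xy.
by rewrite xy adj_irr in Gxy.
Qed.

Lemma deg_compl (T : finType) (G : sgraph T) x :
  (deg (compl G) x + deg G x).+1 = #|T|.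
Proof.
rewrite !deg_sum -big_split /= (cardD1 x) -sum1_card [in RHS]big_mkcond /=.
congr _.+1; apply: eq_bigr => y _; rewrite !inE andbT /compl_adj eq_sym.
by case: eqP => [->|_]; rewrite ?adj_irr //; case: (G x y).
Qed.

Lemma deg_join_inl (T U : finType) (G : sgraph T) (H : sgraph U) x :
  deg (join G H) (inl x) = (deg G x + #|U|)%N.
Proof. by rewrite !deg_sum big_sumType /= sum1_card. Qed.

Lemma deg_join_inr (T U : finType) (G : sgraph T) (H : sgraph U) x :
  deg (join G H) (inr x) = (#|T| + deg H x)%N.
Proof. by rewrite !deg_sum big_sumType /= sum1_card. Qed.

Lemma deg_complete p (i : 'I_p) : (deg (complete p) i).+1 = p.
Proof.
rewrite deg_sum -[in RHS](card_ord p) (cardD1 i) -sum1_card [in RHS]big_mkcond.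
by congr _.+1; apply: eq_bigr => j _; rewrite !inE andbT /= /complete_adj eq_sym.
Qed.

(** The complement of the join is [G] with [p] isolated vertices, so together they have N(N - 1)/2
    edges, where N = #|T| + p. The additive form avoids truncated subtraction. *)
Lemma card_edges_join_compl (T : finType) (G : sgraph T) p :
  (2 * #|edges (join (compl G) (complete p))| + 2 * #|edges G| + (#|T| + p)
   = (#|T| + p) ^ 2)%N.
Proof.
rewrite !handshake big_sumType /=.
under eq_bigr do rewrite deg_join_inl card_ord.
under [X in (_ + X + _ + _)%N]eq_bigr do rewrite deg_join_inr.
have: (\sum_x (deg (compl G) x + deg G x).+1 = #|T| * #|T|)%N.
  by under eq_bigr do rewrite deg_compl; rewrite sum_nat_const.
under eq_bigr do rewrite -addn1; rewrite !big_split /= sum1_card.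
have: (\sum_i (deg (complete p) i).+1 = p * p)%N.
  by under eq_bigr do rewrite deg_complete; rewrite sum_nat_const card_ord.
under eq_bigr do rewrite -addn1; rewrite !big_split /= sum1_card.
by rewrite !sum_nat_const card_ord (@eq_card _ xpredT T) //; nia.
Qed.

(** * Laplacian spectra and the energy of the join *)

(** Comparing vertices instead of indices makes each entry a function of two vertices, as
    [det_reindex] requires. *)
Lemma laplacianE (R : rcfType) (T : finType) (G : sgraph T) : laplacian R G =
  \matrix_(i, j) ((deg G (enum_val i))%:R *+ (enum_val i == enum_val j)
                  - (G (enum_val i) (enum_val j))%:R).
Proof.
by apply/matrixP => i j; rewrite !mxE (inj_eq enum_val_inj).
Qed.

Section Spectrum.
Variables (R : rcfType) (T : finType) (G : sgraph T).

Lemma sum_row_laplacian i : \sum_j laplacian R G i j = 0.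
Proof.
under eq_bigr do rewrite laplacianE mxE.
rewrite sumrB -natr_sum (bigD1 i) //= eqxx mulr1n big1 => [|j ji]; last first.
  by rewrite (inj_eq enum_val_inj) eq_sym (negbTE ji).
by rewrite addr0 deg_sum (reindex _ (onW_bij _ (@enum_val_bij T))) subrr.
Qed.

(** The coefficient of degree #|T| - 1 of the characteristic polynomial is minus the sum of the
    roots and also minus the trace, which is the degree sum. *)
Lemma sum_laplacian_spectrum :
  (0 < #|T|)%N -> \sum_(x <- laplacian_spectrum R G) x = (2 * #|edges G|)%:R.
Proof.
move=> T_gt0; have sz := size_laplacian_spectrum R G.
apply: oppr_inj; rewrite -coefPn_prod_XsubC; last by rewrite sz -lt0n.
rewrite -char_poly_laplacian sz char_poly_trace //; congr (- _).
rewrite handshake natr_sum (reindex _ (onW_bij _ (@enum_val_bij T))) /=.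
apply: eq_bigr => i _.
by rewrite laplacianE mxE eqxx adj_irr subr0.
Qed.

Lemma laplacian_spectrum_0 : (0 < #|T|)%N -> 0 \in laplacian_spectrum R G.
Proof.
move=> T_gt0; rewrite -root_prod_XsubC -char_poly_laplacian.
rewrite -eigenvalue_root_char; apply/eigenvalueP; exists (const_mx 1).
  (* Eigenvectors are rows here, so column sums appear; symmetry turns them into row sums. *)
  rewrite scale0r; apply/matrixP => i j; rewrite !mxE -[RHS](sum_row_laplacian j).
  by apply: eq_bigr => k _; rewrite mxE mul1r -[in LHS]laplacian_sym mxE.
apply/eqP => /matrixP/(_ 0 (Ordinal T_gt0))/eqP.
by rewrite !mxE oner_eq0.
Qed.

(* The join is the complement of G with p isolated vertices added, so its
   Laplacian is N I - J - diag(L(G), 0) with J the all-ones matrix.  Since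
   L(G) annihilates the all-ones vector, the rank-one term J only replaces one
   factor X - N of the characteristic polynomial by X. *)
Lemma char_poly_join_compl p (N := (#|T| + p)%:R : R) :
  char_poly (laplacian R (join (compl G) (complete p))) * ('X - N%:P) =
  ('X - N%:P) ^+ p * (\prod_(x <- laplacian_spectrum R G) ('X - (N - x)%:P)) * 'X.
Proof.
pose g (k : 'I_(#|T| + p)) : T + 'I_p :=
  match split k with inl i => inl (enum_val i) | inr i => inr i end.
have g_bij : bijective g.
  exists (fun u => match u with inl x => lshift p (enum_rank x)
                              | inr i => rshift #|T| i end).
    by move=> k; rewrite /g -[RHS]splitK; case: (split k) => i //=; rewrite enum_valK.
  by case=> [x|i]; rewrite /g ?(unsplitK (inl _)) ?(unsplitK (inr _)) ?enum_rankK.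
pose c : {poly R} := 'X - N%:P.
pose A := block_mx (c%:M + map_mx polyC (laplacian R G)) 0 0 (c%:M : 'M_p).
have -> : char_poly (laplacian R (join (compl G) (complete p))) =
    \det (A + const_mx 1 *m (const_mx 1 : 'M_(1, _))).
  rewrite /char_poly; pose F (u v : T + 'I_p) : {poly R} := 'X *+ (u == v) -
    ((deg (join (compl G) (complete p)) u)%:R *+ (u == v)
     - (join (compl G) (complete p) u v)%:R)%:P.
  have -> : char_poly_mx (laplacian R (join (compl G) (complete p))) =
      \matrix_(i, j) F (enum_val i) (enum_val j).
    by apply/matrixP => i j; rewrite laplacianE !mxE /F (inj_eq enum_val_inj).
  apply: etrans (det_reindex F g_bij) _; congr (\det _).
  have gl i : g (lshift p i) = inl (enum_val i) by rewrite /g (unsplitK (inl i)).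
  have gr i : g (rshift #|T| i) = inr i by rewrite /g (unsplitK (inr i)).
  apply/matrixP => i j; rewrite [LHS]mxE [RHS]mxE.
  have -> : ((const_mx 1 : 'cV_(#|T| + p)) *m
             (const_mx 1 : 'rV[{poly R}]_(#|T| + p))) i j = 1.
    by rewrite mxE big_ord1 !mxE mul1r.
  rewrite /A -[i]splitK -[j]splitK; case: (split i) (split j) => {}i [] {}j /=.
  - rewrite block_mxEul laplacianE !gl !mxE /F (inj_eq inl_inj) (inj_eq enum_val_inj).
    rewrite deg_join_inl card_ord /= /compl_adj (inj_eq enum_val_inj) /c /N.
    (* N is rewritten through the degrees at this vertex, so that the diagonal entries agree by ring
       arithmetic. *)
    have -> : (#|T| + p =
               deg (compl G) (enum_val i) + p + deg G (enum_val i) + 1)%N.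
      by rewrite -[in LHS](deg_compl G (enum_val i)); lia.
    case: eqP => [->|_]; rewrite ?adj_irr /= ?mulr1n ?mulr0n !rmorphB
                                 ?rmorphD ?rmorph_nat ?rmorph0 /=.
      by ring.
    by case: (G _ _) => /=; ring.
  - by rewrite block_mxEur gl gr !mxE /F /= !mulr0n rmorphB rmorph0 /=; ring.
  - by rewrite block_mxEdl gl gr !mxE /F /= !mulr0n rmorphB rmorph0 /=; ring.
  - rewrite block_mxEdr !gr !mxE /F (inj_eq inr_inj).
    rewrite deg_join_inr /= /complete_adj /c /N.
    rewrite -[in X in _ = ('X - (_ + X)%:R%:P) *+ _ + _](deg_complete i).
    case: eqP => [->|_] /=; rewrite ?mulr1n ?mulr0n !rmorphB
                                    ?rmorphD ?rmorph_nat ?rmorph0 /=.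
      by rewrite -addn1 !natrD; ring.
    by ring.
(* The all-ones column is an eigenvector of [A] for [c], since the rows of the Laplacian of [G] sum
   to 0. *)
rewrite (@det_rank1_update _ _ _ _ _ c); last first.
  rewrite -col_mx_const mul_block_col !mul0mx add0r addr0 mulmxDl !mul_scalar_mx.
  rewrite scale_col_mx; congr col_mx; rewrite -[RHS]addr0; congr (_ + _).
  apply/matrixP => i j; rewrite !mxE -[RHS]/(0%:P) -(sum_row_laplacian i) rmorph_sum.
  by apply: eq_bigr => k _; rewrite !mxE mulr1.
rewrite /A det_ublock det_scalar.
rewrite (det_scalar_add _ (char_poly_laplacian R G)) ?size_laplacian_spectrum //.
(* The all-ones row times the all-ones column is N, and N + (X - N) = X. *)
have -> : ((const_mx 1 : 'rV_(#|T| + p)) *m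
           (const_mx 1 : 'cV[{poly R}]_(#|T| + p))) 0 0 + c = 'X.
  rewrite mxE; under eq_bigr do rewrite !mxE mulr1.
  by rewrite sumr_const card_ord /c /N rmorph_nat; ring.
rewrite [X in X * _]mulrC; congr (_ * _ * _).
by apply: eq_bigr => x _; rewrite /c rmorphB; ring.
Qed.

Hypothesis conn_gt0 : 0 < algebraic_connectivity R G.

(** Positive connectivity excludes lists shorter than two, where it defaults to 0. By sortedness
    every entry after the head is then positive, so the eigenvalue 0 is the head. *)
Lemma laplacian_spectrum_cons :
  laplacian_spectrum R G = 0 :: behead (laplacian_spectrum R G).
Proof.
have := sorted_laplacian_spectrum R G; have := laplacian_spectrum_0.
move: conn_gt0; rewrite /algebraic_connectivity -(size_laplacian_spectrum R G).
case: (laplacian_spectrum R G) => [|x [|y s]] /=; rewrite ?ltxx // => y_gt0.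
move=> /(_ isT); rewrite inE => /predU1P[<- //|].
move=> s0 /andP[_]; rewrite (path_sortedE le_trans) => /andP[/allP y_le _].
move: s0; rewrite inE => /predU1P[y0|/y_le]; last by rewrite leNgt y_gt0.
by rewrite -y0 ltxx in y_gt0.
Qed.

Lemma algebraic_connectivity_min x :
  x \in behead (laplacian_spectrum R G) -> algebraic_connectivity R G <= x.
Proof.
have := sorted_laplacian_spectrum R G.
rewrite /algebraic_connectivity; case: (laplacian_spectrum R G) => [|y [|z s]] //=.
rewrite (path_sortedE le_trans) => /andP[_ /andP[/allP z_le _]].
by rewrite inE => /predU1P[->|/z_le].
Qed.

(** The eigenvalue 0 of [G] contributes a factor X - N, which cancels the one on the left of
    [char_poly_join_compl]. *)
Lemma laplacian_spectrum_join_compl p (N := (#|T| + p)%:R : R) :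
  perm_eq (laplacian_spectrum R (join (compl G) (complete p)))
    (0 :: nseq p N ++ [seq N - x | x <- behead (laplacian_spectrum R G)]).
Proof.
apply: prod_XsubC_eq; rewrite -char_poly_laplacian.
have cN0 : 'X - N%:P != 0 by rewrite polyXsubC_eq0.
apply: (mulIf cN0); rewrite char_poly_join_compl laplacian_spectrum_cons.
rewrite !big_cons big_cat /= big_map !subr0.
by rewrite big_nseq iter_mulr_1; ring.
Qed.

(** Here [d] is the average degree of the join. The first two absolute values may stay unresolved,
    as they involve only #|T|, [p] and the edge count; only the terms N - x need a sign, and N - x -
    d <= 0. *)
Lemma laplacian_energy_join_compl p (N := (#|T| + p)%:R : R)
    (m2 := (2 * #|edges G|)%:R : R) (d := N - 1 - m2 / N) :
  1 + m2 / N <= algebraic_connectivity R G ->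
  laplacian_energy R (join (compl G) (complete p)) =
  `|d| + p%:R * `|N - d| + m2 - (#|T|.-1)%:R * (1 + m2 / N).
Proof.
move=> conn_ge.
have T_gt0 : (0 < #|T|)%N.
  rewrite -(size_laplacian_spectrum R G); move: conn_gt0; rewrite /algebraic_connectivity.
  by case: (laplacian_spectrum R G); rewrite ?ltxx.
have N0 : N != 0 by rewrite pnatr_eq0 -lt0n addn_gt0 T_gt0.
rewrite /laplacian_energy card_sum card_ord.
have -> : (2 * #|edges (join (compl G) (complete p))|)%:R / (#|T| + p)%:R = d.
  have := congr1 (fun k => k%:R : R) (card_edges_join_compl G p).
  rewrite natrX natrD [X in X + _ = _]natrD -/N -/m2 => /esym eN.
  have -> : (2 * #|edges (join (compl G) (complete p))|)%:R = N ^+ 2 - N - m2.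
    by rewrite eN; ring.
  by rewrite -/N /d; field; rewrite -natrD.
rewrite (perm_big _ (laplacian_spectrum_join_compl p)) big_cons big_cat /= big_map.
rewrite sub0r normrN -[RHS]addrA -[RHS]addrA; congr (_ + (_ + _)).
  by rewrite big_nseq iter_addr_0 mulr_natl.
have sum_m2 : \sum_(x <- behead (laplacian_spectrum R G)) x = m2.
  by rewrite /m2 -sum_laplacian_spectrum // laplacian_spectrum_cons big_cons add0r.
rewrite -[X in _ = X - _]sum_m2.
have <- : size (behead (laplacian_spectrum R G)) = #|T|.-1.
  by rewrite size_behead size_laplacian_spectrum.
set s := behead _.
have -> : (size s)%:R * (1 + m2 / N) = \sum_(x <- s) (1 + m2 / N).
  by rewrite big_const_seq count_predT iter_addr_0 mulr_natl.
rewrite -sumrB big_seq [RHS]big_seq.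
apply: eq_bigr => x /algebraic_connectivity_min x_ge.
have -> : N - x - d = - (x - (1 + m2 / N)) by rewrite /d; ring.
by rewrite normrN ger0_norm // subr_ge0 (le_trans conn_ge).
Qed.

End Spectrum.

Theorem theorem3p3 (R : rcfType) (T1 T2 : finType)
    (G1 : sgraph T1) (G2 : sgraph T2) (n m p : nat) :
  #|T1| = n -> #|T2| = n ->
  #|edges G1| = m -> #|edges G2| = m ->
  connected G1 -> connected G2 ->
  1 < algebraic_connectivity R G1 ->
  1 < algebraic_connectivity R G2 ->
  (0 < p)%N ->
  (2 * m)%:R / (p + n)%:R <
    Num.min (algebraic_connectivity R G1 - 1)
            (algebraic_connectivity R G2 - 1) ->
  laplacian_energy R (join (compl G1) (complete p)) =
  laplacian_energy R (join (compl G2) (complete p)).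
Proof.
move=> n1 n2 m1 m2 _ _ c1 c2 _; rewrite addnC lt_min => /andP[d1 d2].
have conn_ge (c d : R) : d < c - 1 -> 1 + d <= c by lra.
(* Both sides become the same expression in [n], [m] and [p]; positivity of the two connectivities
   remains. *)
rewrite !laplacian_energy_join_compl ?n1 ?n2 ?m1 ?m2 ?conn_ge //;
  exact: lt_trans ltr01 _.
Qed.
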